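(* Let $\Bbbk$ be a field. The variety of Lie Rota--Baxter algebras (of weight zero) over $\Bbbk$ is not a Schreier variety.
   Context: A Lie Rota--Baxter algebra of weight zero is a Lie algebra $A$ over $\Bbbk$ with a linear map $R\colon A\to A$ satisfying $[R(x),R(y)]=R([R(x),y]+[x,R(y)])$ for all $x,y\in A$; homomorphisms commute with the bracket and $R$, and subalgebras are subspaces closed under the bracket and $R$. A variety $\mathcal V$ of algebras is called Schreier if every subalgebra of a free $\mathcal V$-algebra is a free $\mathcal V$-algebra. *)

(* Defs.v *)
From HB Require Import structures.
From mathcomp Require Import all_boot all_algebra.
Set Implicit Arguments.
Unset Strict Implicit.
Unset Printing Implicit Defensive.
Import GRing.Theory.
Local Open Scope ring_scope.

(* No assumption is made on the characteristic or on the dimension;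
   antisymmetry is imposed in the alternating form [x, x] = 0, as is required
   in characteristic 2. *)
HB.mixin Record Lmodule_isLie (k : fieldType) A of GRing.Lmodule k A := {
  lie : A -> A -> A;
  lie_linearl : forall y : A, linear (lie^~ y);
  lie_linearr : forall x : A, linear (lie x);
  liexx : forall x : A, lie x x = 0;
  lie_jacobi : forall x y z : A,
    lie x (lie y z) + lie y (lie z x) + lie z (lie x y) = 0
}.

#[short(type="lieType")]
HB.structure Definition Lie (k : fieldType) :=
  {A of GRing.Lmodule k A & Lmodule_isLie k A}.

HB.mixin Record Lie_isLieRotaBaxter (k : fieldType) A of Lie k A := {
  rb : A -> A;
  rb_linear : linear rb;
  rb_lie : forall x y : A,
    lie (rb x) (rb y) = rb (lie (rb x) y + lie x (rb y))
}.

#[short(type="lieRBType")]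
HB.structure Definition LieRotaBaxter (k : fieldType) :=
  {A of Lie k A & Lie_isLieRotaBaxter k A}.

Definition lieRB_hom (k : fieldType) (A B : lieRBType k)
    (f : {linear A -> B}) : Prop :=
  (forall x y : A, f (lie x y) = lie (f x) (f y)) /\
  (forall x : A, f (rb x) = rb (f x)).

(* Membership is Boolean; classically every subset is of this form, and the
   negation of the Schreier property is all the stronger constructively. *)
Record subalgebra (k : fieldType) (A : lieRBType k) := Subalgebra {
  subalg_pred :> {pred A};
  subalg_submod : submod_closed subalg_pred;
  subalg_lie : {in subalg_pred &, forall x y, lie x y \in subalg_pred};
  subalg_rb : {in subalg_pred, forall x, rb x \in subalg_pred}
}.

(* The subtype of the elements of S, on which the instances below put the
   Lie Rota--Baxter structure restricted from A. *)
Record subalg_of (k : fieldType) (A : lieRBType k) (S : subalgebra A) :=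
  SubalgOf { subalg_val : A; _ : subalg_val \in subalg_pred S }.

Section SubalgebraStructure.
Variables (k : fieldType) (A : lieRBType k) (S : subalgebra A).

HB.instance Definition _ :=
  GRing.isSubmodClosed.Build k A (subalg_pred S) (subalg_submod S).

HB.instance Definition _ := [isSub for @subalg_val k A S].
HB.instance Definition _ := [Choice of subalg_of S by <:].
HB.instance Definition _ := [SubChoice_isSubLmodule of subalg_of S by <:].

Definition sub_lie (x y : subalg_of S) : subalg_of S :=
  SubalgOf (subalg_lie (valP x) (valP y)).

Definition sub_rb (x : subalg_of S) : subalg_of S :=
  SubalgOf (subalg_rb (valP x)).

Fact sub_lie_linearl y : linear (sub_lie^~ y).
Proof. by move=> a u v; apply: val_inj; rewrite /= lie_linearl. Qed.

Fact sub_lie_linearr x : linear (sub_lie x).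
Proof. by move=> a u v; apply: val_inj; rewrite /= lie_linearr. Qed.

Fact sub_liexx x : sub_lie x x = 0.
Proof. by apply: val_inj; rewrite /= liexx. Qed.

Fact sub_lie_jacobi x y z :
  sub_lie x (sub_lie y z) + sub_lie y (sub_lie z x) + sub_lie z (sub_lie x y)
  = 0.
Proof. by apply: val_inj; rewrite /= lie_jacobi. Qed.

HB.instance Definition _ := Lmodule_isLie.Build k (subalg_of S)
  sub_lie_linearl sub_lie_linearr sub_liexx sub_lie_jacobi.

Fact sub_rb_linear : linear sub_rb.
Proof. by move=> a u v; apply: val_inj; rewrite /= rb_linear. Qed.

Fact sub_rb_lie x y :
  lie (sub_rb x) (sub_rb y) = sub_rb (lie (sub_rb x) y + lie x (sub_rb y)).
Proof. by apply: val_inj; rewrite /= rb_lie. Qed.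

HB.instance Definition _ := Lie_isLieRotaBaxter.Build k (subalg_of S)
  sub_rb_linear sub_rb_lie.

End SubalgebraStructure.

(* Injectivity of i need not be required: it follows by testing against the
   abelian algebra k with zero operator. *)
Definition lieRB_free_on (k : fieldType) (A : lieRBType k) (X : Type)
    (i : X -> A) : Prop :=
  forall (B : lieRBType k) (f : X -> B),
  exists h : {linear A -> B},
    [/\ lieRB_hom h, (forall x : X, h (i x) = f x)
      & forall h' : {linear A -> B},
          lieRB_hom h' -> (forall x : X, h' (i x) = f x) -> h' =1 h].

Definition lieRB_free (k : fieldType) (A : lieRBType k) : Prop :=
  exists (X : Type) (i : X -> A), lieRB_free_on i.

Definition lieRB_variety_Schreier (k : fieldType) : Prop :=
  forall A : lieRBType k, lieRB_free A ->
  forall S : subalgebra A, lieRB_free (subalg_of S : lieRBType k).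

(* Main.v *)
Require Import Defs.
From HB Require Import structures.
From mathcomp Require Import all_boot all_algebra.
From mathcomp Require Import boolp.
From mathcomp Require Import ring.
Set Implicit Arguments.
Unset Strict Implicit.
Unset Printing Implicit Defensive.
Import GRing.Theory.
Local Open Scope ring_scope.
Local Open Scope quotient_scope.

(* A free algebra is projective, so it suffices to find a subalgebra S of the
   free algebra on x, y and a homomorphism on S that does not lift along some
   surjection.  The elements a = x, b = R y and c = [R x, y] + [x, R y] satisfy
   [R a, b] = R c.  Map x, y to the abelian algebra with basis x, x' = R x,
   y, y' = R y, and let S be the preimage of <x, x', y'>, so that a, b, c lie
   in S.  The Heisenberg algebra <x, x', y', e> with [x', y'] = e, R x = x' and
   R = 0 on x', y', e maps onto <x, x', y'> with kernel <e>.  Any lift of S to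
   it sends [R a, b] to e, whereas R c goes to a multiple of x'. *)

(** * Free Lie Rota--Baxter algebras as quotients of terms *)

Section FreeAlgebra.
Variables (k : fieldType) (X : Type).

Inductive term :=
| TVar of X
| TZero
| TOpp of term
| TAdd of term & term
| TScale of k & term
| TLie of term & term
| TRb of term.

(** [X] is an arbitrary type, so decidable equality and choice on terms are taken from the classical
    axioms. *)
HB.instance Definition _ := gen_eqMixin term.
HB.instance Definition _ := gen_choiceMixin term.

Fixpoint eval (B : lieRBType k) (f : X -> B) (t : term) : B :=
  match t with
  | TVar x => f x
  | TZero => 0
  | TOpp t => - eval f t
  | TAdd t u => eval f t + eval f u
  | TScale a t => a *: eval f t
  | TLie t u => lie (eval f t) (eval f u)
  | TRb t => rb (eval f t)
  end.

(* Identifying the terms that agree in every algebra, rather than by the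
   congruence generated by the axioms, makes each law of the quotient an
   instance of the same law in the target algebras. *)
Definition term_eqv (t u : term) : bool :=
  `[< forall (B : lieRBType k) (f : X -> B), eval f t = eval f u >].

Fact term_eqv_refl : reflexive term_eqv.
Proof. by move=> t; apply/asboolP. Qed.

Fact term_eqv_sym : symmetric term_eqv.
Proof.
by move=> t u; apply/asboolP/asboolP => tu B f; rewrite tu.
Qed.

Fact term_eqv_trans : transitive term_eqv.
Proof.
by move=> u t v /asboolP tu /asboolP uv; apply/asboolP => B f; rewrite tu.
Qed.

Canonical term_equiv := EquivRel term_eqv term_eqv_refl term_eqv_sym
  term_eqv_trans.

Definition freeRB := {eq_quot term_equiv}.
HB.instance Definition _ := Choice.on freeRB.

Definition cls (t : term) : freeRB := \pi_{eq_quot term_equiv} t.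
Definition rep (u : freeRB) : term := repr (u : {eq_quot term_equiv}).

Definition lift (B : lieRBType k) (f : X -> B) (u : freeRB) : B :=
  eval f (rep u).

Lemma repK : cancel rep cls.
Proof. exact: reprK. Qed.

(** The chosen representative of [cls t] need not be [t], but equivalent terms have equal values by
    the definition of [term_eqv]. *)
Lemma lift_cls (B : lieRBType k) (f : X -> B) t : lift f (cls t) = eval f t.
Proof.
have /eqmodP/asboolP : rep (cls t) = t %[mod {eq_quot term_equiv}].
  exact: reprK.
exact.
Qed.

Lemma lift_inj (u v : freeRB) :
  (forall (B : lieRBType k) (f : X -> B), lift f u = lift f v) -> u = v.
Proof.
move=> uv; rewrite -(repK u) -(repK v).
by apply/eqmodP/asboolP => B f; apply: uv.
Qed.

Definition free_zero := cls TZero.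
Definition free_opp u := cls (TOpp (rep u)).
Definition free_add u v := cls (TAdd (rep u) (rep v)).
Definition free_scale a u := cls (TScale a (rep u)).
Definition free_lie u v := cls (TLie (rep u) (rep v)).
Definition free_rb u := cls (TRb (rep u)).

Lemma lift0 (B : lieRBType k) (f : X -> B) : lift f free_zero = 0.
Proof. exact: lift_cls. Qed.

Lemma liftN (B : lieRBType k) (f : X -> B) u : lift f (free_opp u) = - lift f u.
Proof. exact: lift_cls. Qed.

Lemma liftD (B : lieRBType k) (f : X -> B) u v :
  lift f (free_add u v) = lift f u + lift f v.
Proof. exact: lift_cls. Qed.

Lemma liftZ (B : lieRBType k) (f : X -> B) a u :
  lift f (free_scale a u) = a *: lift f u.
Proof. exact: lift_cls. Qed.

Lemma lift_lie (B : lieRBType k) (f : X -> B) u v :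
  lift f (free_lie u v) = lie (lift f u) (lift f v).
Proof. exact: lift_cls. Qed.

Lemma lift_rb (B : lieRBType k) (f : X -> B) u :
  lift f (free_rb u) = rb (lift f u).
Proof. exact: lift_cls. Qed.

Definition liftE := (lift0, liftN, liftD, liftZ, lift_lie, lift_rb).

Fact free_addA : associative free_add.
Proof. by move=> u v w; apply: lift_inj => B f; rewrite !liftE addrA. Qed.

Fact free_addC : commutative free_add.
Proof. by move=> u v; apply: lift_inj => B f; rewrite !liftE addrC. Qed.

Fact free_add0 : left_id free_zero free_add.
Proof. by move=> u; apply: lift_inj => B f; rewrite !liftE add0r. Qed.

Fact free_addN : left_inverse free_zero free_opp free_add.
Proof. by move=> u; apply: lift_inj => B f; rewrite !liftE addNr. Qed.

HB.instance Definition _ := GRing.isZmodule.Build freeRB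
  free_addA free_addC free_add0 free_addN.

Fact free_scaleA a b u : free_scale a (free_scale b u) = free_scale (a * b) u.
Proof. by apply: lift_inj => B f; rewrite !liftE scalerA. Qed.

Fact free_scale1 : left_id 1 free_scale.
Proof. by move=> u; apply: lift_inj => B f; rewrite !liftE scale1r. Qed.

Fact free_scaleDr : right_distributive free_scale +%R.
Proof. by move=> a u v; apply: lift_inj => B f; rewrite !liftE scalerDr. Qed.

Fact free_scaleDl u : {morph free_scale^~ u : a b / a + b}.
Proof. by move=> a b; apply: lift_inj => B f; rewrite !liftE scalerDl. Qed.

HB.instance Definition _ := GRing.Zmodule_isLmodule.Build k freeRB
  free_scaleA free_scale1 free_scaleDr free_scaleDl.

Fact lift_linear (B : lieRBType k) (f : X -> B) : linear (lift f).
Proof. by move=> a u v; rewrite !liftE. Qed.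

HB.instance Definition _ (B : lieRBType k) (f : X -> B) :=
  GRing.isLinear.Build k freeRB B _ (lift f) (lift_linear f).

Fact free_lie_linearl v : linear (free_lie^~ v).
Proof.
move=> a u w; apply: lift_inj => B f.
by rewrite linearP /= !lift_lie linearP lie_linearl.
Qed.

Fact free_lie_linearr u : linear (free_lie u).
Proof.
move=> a v w; apply: lift_inj => B f.
by rewrite linearP /= !lift_lie linearP lie_linearr.
Qed.

Fact free_liexx u : free_lie u u = 0.
Proof. by apply: lift_inj => B f; rewrite lift_lie liexx linear0. Qed.

Fact free_lie_jacobi u v w :
  free_lie u (free_lie v w) + free_lie v (free_lie w u)
    + free_lie w (free_lie u v) = 0.
Proof.
by apply: lift_inj => B f; rewrite linear0 !linearD /= !lift_lie lie_jacobi.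
Qed.

HB.instance Definition _ := Lmodule_isLie.Build k freeRB
  free_lie_linearl free_lie_linearr free_liexx free_lie_jacobi.

Fact free_rb_linear : linear free_rb.
Proof.
move=> a u v; apply: lift_inj => B f.
by rewrite linearP /= !lift_rb linearP rb_linear.
Qed.

Fact free_rb_lie u v :
  lie (free_rb u) (free_rb v) = free_rb (lie (free_rb u) v + lie u (free_rb v)).
Proof. by apply: lift_inj => B f; rewrite lift_rb linearD /= !liftE rb_lie. Qed.

HB.instance Definition _ := Lie_isLieRotaBaxter.Build k freeRB
  free_rb_linear free_rb_lie.

Definition free_var (x : X) : freeRB := cls (TVar x).

Lemma lift_var (B : lieRBType k) (f : X -> B) x : lift f (free_var x) = f x.
Proof. exact: lift_cls. Qed.

Lemma lift_hom (B : lieRBType k) (f : X -> B) :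
  lieRB_hom (lift f : {linear freeRB -> B}).
Proof. by split=> *; rewrite /= !liftE. Qed.

(** The uniqueness half of freeness, by induction on the term. In each case [lift_inj] identifies
    the class of a compound term with the operation applied to classes. *)
Lemma lieRB_hom_cls (B : lieRBType k) (f : X -> B) (h : {linear freeRB -> B}) :
    lieRB_hom h -> (forall x, h (free_var x) = f x) ->
  forall t, h (cls t) = eval f t.
Proof.
move=> [h_lie h_rb] h_var.
elim=> [x||t IH|t IHt u IHu|a t IH|t IHt u IHu|t IH] /=.
- exact: h_var.
- by rewrite -(linear0 h).
- by rewrite -IH -linearN; congr (h _); apply: lift_inj => B' f';
    rewrite linearN /= !lift_cls.
- by rewrite -IHt -IHu -linearD; congr (h _); apply: lift_inj => B' f';
    rewrite linearD /= !lift_cls.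
- by rewrite -IH -linearZ; congr (h _); apply: lift_inj => B' f';
    rewrite linearZ /= !lift_cls.
- by rewrite -IHt -IHu -h_lie; congr (h _); apply: lift_inj => B' f';
    rewrite lift_lie !lift_cls.
- by rewrite -IH -h_rb; congr (h _); apply: lift_inj => B' f';
    rewrite lift_rb !lift_cls.
Qed.

Lemma freeRB_free_on : lieRB_free_on free_var.
Proof.
move=> B f; exists (lift f); split; [exact: lift_hom|exact: lift_var|].
by move=> h h_hom h_var u; rewrite -{1}(repK u) (lieRB_hom_cls h_hom h_var).
Qed.

End FreeAlgebra.

(** * The abelian and Heisenberg algebras, and the projection between them *)

Section TestAlgebras.
Variable k : fieldType.

(* Coordinates in the basis x, x', y, y'. *)
Definition abelianRB : Type := (k^o * k^o * k^o * k^o)%type.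
HB.instance Definition _ := GRing.Lmodule.on abelianRB.

Definition abelian_lie (u v : abelianRB) : abelianRB := 0.
Definition abelian_rb (u : abelianRB) : abelianRB :=
  let: (p, q, r, s) := u in (0, p, 0, r).

Fact abelian_lie_linearl v : linear (abelian_lie^~ v).
Proof. by move=> a u w; rewrite /abelian_lie scaler0 addr0. Qed.

Fact abelian_lie_linearr u : linear (abelian_lie u).
Proof. by move=> a v w; rewrite /abelian_lie scaler0 addr0. Qed.

Fact abelian_liexx u : abelian_lie u u = 0.
Proof. by []. Qed.

Fact abelian_lie_jacobi u v w :
  abelian_lie u (abelian_lie v w) + abelian_lie v (abelian_lie w u)
    + abelian_lie w (abelian_lie u v) = 0.
Proof. by rewrite /abelian_lie !addr0. Qed.

HB.instance Definition _ := Lmodule_isLie.Build k abelianRB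
  abelian_lie_linearl abelian_lie_linearr abelian_liexx abelian_lie_jacobi.

Fact abelian_rb_linear : linear abelian_rb.
Proof.
by move=> a [[[p q] r] s] [[[p' q'] r'] s']; congr (_, _, _, _);
  rewrite /= scaler0 addr0.
Qed.

Fact abelian_rb_lie u v : lie (abelian_rb u) (abelian_rb v) =
  abelian_rb (lie (abelian_rb u) v + lie u (abelian_rb v)).
Proof. by rewrite /lie /= /abelian_lie addr0. Qed.

HB.instance Definition _ := Lie_isLieRotaBaxter.Build k abelianRB
  abelian_rb_linear abelian_rb_lie.

(* Coordinates in the basis x, x', y', e. *)
Definition heisRB : Type := (k^o * k^o * k^o * k^o)%type.
HB.instance Definition _ := GRing.Lmodule.on heisRB.

Definition heis_lie (u v : heisRB) : heisRB :=
  let: (_, q, r, _) := u in let: (_, q', r', _) := v in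
  (0, 0, 0, q * r' - r * q').

Definition heis_rb (u : heisRB) : heisRB :=
  let: (p, _, _, _) := u in (0, p, 0, 0).

Fact heis_lie_linearl v : linear (heis_lie^~ v).
Proof.
case: v => [[[p q] r] s] a [[[p1 q1] r1] s1] [[[p2 q2] r2] s2].
(* Only the [e]-coordinate is nontrivial; there the scaling of [k^o] is unfolded to the product of
   [k] for [ring]. *)
by congr (_, _, _, _); rewrite /= ?scaler0 ?addr0 // /GRing.scale /=; ring.
Qed.

Fact heis_lie_linearr u : linear (heis_lie u).
Proof.
case: u => [[[p q] r] s] a [[[p1 q1] r1] s1] [[[p2 q2] r2] s2].
by congr (_, _, _, _); rewrite /= ?scaler0 ?addr0 // /GRing.scale /=; ring.
Qed.

Fact heis_liexx u : heis_lie u u = 0.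
Proof. by case: u => [[[p q] r] s]; congr (_, _, _, _); rewrite /=; ring. Qed.

Fact heis_lie_jacobi u v w :
  heis_lie u (heis_lie v w) + heis_lie v (heis_lie w u)
    + heis_lie w (heis_lie u v) = 0.
Proof.
case: u v w => [[[p q] r] s] [[[p1 q1] r1] s1] [[[p2 q2] r2] s2].
by congr (_, _, _, _); rewrite /=; ring.
Qed.

HB.instance Definition _ := Lmodule_isLie.Build k heisRB
  heis_lie_linearl heis_lie_linearr heis_liexx heis_lie_jacobi.

Fact heis_rb_linear : linear heis_rb.
Proof.
by move=> a [[[p q] r] s] [[[p' q'] r'] s']; congr (_, _, _, _);
  rewrite /= scaler0 addr0.
Qed.

(** Both sides vanish: the image of R is the line spanned by x', and brackets lie in the span of e,
    which R kills. *)
Fact heis_rb_lie u v : lie (heis_rb u) (heis_rb v) =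
  heis_rb (lie (heis_rb u) v + lie u (heis_rb v)).
Proof.
case: u v => [[[p q] r] s] [[[p1 q1] r1] s1].
by congr (_, _, _, _); rewrite /=; ring.
Qed.

HB.instance Definition _ := Lie_isLieRotaBaxter.Build k heisRB
  heis_rb_linear heis_rb_lie.

(** The quotient by e. The y'-coordinate is third in the source and fourth in the target; the image
    is the hyperplane where y has coefficient 0. *)
Definition heis_proj (u : heisRB) : abelianRB :=
  let: (p, q, r, _) := u in (p, q, 0, r).

(** A right inverse of [heis_proj] on its image. It does not preserve brackets, since [x', y'] =
    e. *)
Definition heis_section (u : abelianRB) : heisRB :=
  let: (p, q, _, s) := u in (p, q, s, 0).

Fact heis_proj_linear : linear heis_proj.
Proof.
by move=> a [[[p q] r] s] [[[p' q'] r'] s']; congr (_, _, _, _);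
  rewrite /= scaler0 addr0.
Qed.

HB.instance Definition _ :=
  GRing.isLinear.Build k heisRB abelianRB _ heis_proj heis_proj_linear.

Lemma heis_proj_hom : lieRB_hom (heis_proj : {linear heisRB -> abelianRB}).
Proof. by split=> [[[[p q] r] s] [[[p' q'] r'] s']|[[[p q] r] s]]. Qed.

End TestAlgebras.

(** * Projectivity of free algebras *)

Lemma lieRB_hom_comp (k : fieldType) (A B C : lieRBType k)
    (g : {linear B -> C}) (f : {linear A -> B}) :
  lieRB_hom g -> lieRB_hom f -> lieRB_hom (g \o f : {linear A -> C}).
Proof. by move=> [gl gr] [fl fr]; split=> *; rewrite /= ?fl ?fr ?gl ?gr. Qed.

(** Send each generator [i x] to the preimage [s (f (i x))] and extend to [g]; then [p \o g] and [f]
    agree on generators, hence everywhere. As [s] is a section only over the image of [f], the map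
    [p] may fail to be surjective. *)
Lemma lieRB_free_lift (k : fieldType) (A B C : lieRBType k)
    (p : {linear B -> C}) (s : C -> B) (f : {linear A -> C}) :
    lieRB_free A -> lieRB_hom p -> lieRB_hom f ->
    (forall a, p (s (f a)) = f a) ->
  exists2 g : {linear A -> B}, lieRB_hom g & forall a, p (g a) = f a.
Proof.
move=> [X [i A_free]] p_hom f_hom psf.
have [g [g_hom g_i _]] := A_free B (s \o f \o i).
exists g => // a; have [h [_ _ h_uniq]] := A_free C (f \o i).
rewrite (h_uniq f) // -(h_uniq (p \o g)) //; first exact: lieRB_hom_comp.
by move=> x; rewrite /= g_i /= psf.
Qed.

(** * A subalgebra of the free algebra on x, y that is not free *)

Section Counterexample.
Variable k : fieldType.

Let A : lieRBType k := freeRB k bool.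
Let x : A := free_var k true.
Let y : A := free_var k false.

Definition to_abelian : {linear A -> abelianRB k} :=
  lift (fun b : bool =>
    (if b then (1, 0, 0, 0) else (0, 0, 1, 0)) : abelianRB k).

Lemma to_abelian_hom : lieRB_hom to_abelian.
Proof. exact: lift_hom. Qed.

Lemma to_abelian_x : to_abelian x = (1, 0, 0, 0).
Proof. exact: lift_var. Qed.

Lemma to_abelian_y : to_abelian y = (0, 0, 1, 0).
Proof. exact: lift_var. Qed.

(** Tuples nest to the left, so [.1.2] is the third coordinate, the coefficient of y. *)
Definition noy : {pred A} := fun u => (to_abelian u).1.2 == 0.

Fact noy_submod : submod_closed noy.
Proof.
split=> [|a u v]; rewrite !unfold_in; first by rewrite linear0.
by move=> /eqP u0 /eqP v0; rewrite linearP /= u0 v0 scaler0 addr0.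
Qed.

Fact noy_lie : {in noy &, forall u v, lie u v \in noy}.
Proof. by move=> u v _ _; rewrite unfold_in to_abelian_hom.1. Qed.

(** The image of R in [abelianRB] is spanned by x' and y'. Membership is stated for every [u] so as
    to apply to y, which lies outside [noy]. *)
Fact noy_rb_any u : rb u \in noy.
Proof.
by rewrite unfold_in to_abelian_hom.2; case: (to_abelian u) => [[[]]] /=.
Qed.

Fact noy_rb : {in noy, forall u, rb u \in noy}.
Proof. by move=> u _; apply: noy_rb_any. Qed.

Definition noy_subalg : subalgebra A := Subalgebra noy_submod noy_lie noy_rb.

Lemma noy_not_free : ~ lieRB_free (subalg_of noy_subalg : lieRBType k).
Proof.
move=> S_free; pose S : lieRBType k := subalg_of noy_subalg.
have a_in : x \in noy by rewrite unfold_in to_abelian_x.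
have c_in : lie (rb x) y + lie x (rb y) \in noy.
  by rewrite unfold_in linearD !to_abelian_hom.1 /= addr0.
pose a : S := SubalgOf (a_in : x \in subalg_pred noy_subalg).
pose b : S := SubalgOf (noy_rb_any y : rb y \in subalg_pred noy_subalg).
pose c : S := SubalgOf (c_in : _ \in subalg_pred noy_subalg).
(* The Rota--Baxter identity of x and y, read in S although y is not in S. *)
have rel_abc : lie (rb a) b = rb c by apply: val_inj; rewrite /= rb_lie.
pose f : {linear S -> abelianRB k} := to_abelian \o (val : S -> A).
have f_hom : lieRB_hom f.
  by split=> *; rewrite /= ?to_abelian_hom.1 ?to_abelian_hom.2.
have f_sec (u : S) : heis_proj (heis_section (f u)) = f u.
  case: u => u u_in; rewrite -[f _]/(to_abelian u).
  move: u_in; rewrite unfold_in.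
  by case: (to_abelian u) => [[[? ?] ?] ?] /eqP /= ->.
have [g [g_lie g_rb] pg] :=
  lieRB_free_lift S_free (heis_proj_hom k) f_hom f_sec.
(* Compare the [e]-coordinates of the images of both sides; that of R (g c) is 0. *)
have := congr1 snd (congr1 g rel_abc); rewrite g_lie !g_rb.
(* Modulo e, g a is x and g b is y', so [R (g a), g b] = [x', y'] = e, and the comparison reads 1 =
   0. *)
have := pg b; have := pg a; rewrite /f /= to_abelian_x.
rewrite to_abelian_hom.2 to_abelian_y.
case: (g a) (g b) (g c) => [[[? ?] ?] ?] [[[? ?] ?] ?] [[[? ?] ?] ?].
move=> [-> _ _] [_ _ ->] /= /eqP.
by rewrite mul0r subr0 mulr1 oner_eq0.
Qed.

End Counterexample.

Theorem corollary2 (k : fieldType) : ~ lieRB_variety_Schreier k.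
Proof.
move=> schreier; apply: (@noy_not_free k); apply: schreier.
by exists bool, (@free_var k bool); apply: freeRB_free_on.
Qed.
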